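(* For any $k \in \mathbb{N}^*$ and for any $m,p,n \in \mathbb{N}$ such that $n \geq p$, we have $$\sum_{N_{k}=p}^{n}\cdots \sum_{N_{1}=p}^{N_2}\left[\binom{N_1+m}{m} \sum_{i=1+m}^{N_1+m}\frac{1}{i}\right]=\binom{n+m+k}{m+k}\sum_{i=1+m+k}^{n+m+k}\frac{1}{i}-\sum_{j=0}^{k-1}\binom{n-p+j}{j}\binom{p-1+m+k-j}{m+k-j} \sum_{i=1+m+k-j}^{p-1+m+k-j}\frac{1}{i}.$$
   Context: $\mathbb{N}=\{0,1,2,\dots\}$ and $\mathbb{N}^*=\{1,2,\dots\}$. Binomial coefficients $\binom{a}{b}$ with $a<b$ are taken to be $0$, and sums whose upper limit is less than the lower limit are $0$. The notation $\sum_{N_k=p}^{n}\cdots\sum_{N_1=p}^{N_2} f(N_1)$ denotes a $k$-fold nested sum: with $N_{k+1}:=n$, the index $N_j$ runs from $p$ to $N_{j+1}$ for $j=k,k-1,\dots,1$; for $k=1$ it is $\sum_{N_1=p}^{n}f(N_1)$. *)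

(* Defs.v *)
From mathcomp Require Import all_boot all_order all_algebra.

Set Implicit Arguments.
Unset Strict Implicit.
Unset Printing Implicit Defensive.

Import GRing.Theory.
Local Open Scope ring_scope.

(* \sum_(N_k = p)^n ... \sum_(N_1 = p)^(N_2) f N_1: the recursion peels off the
   outermost index N_k, which becomes the upper bound of the remaining k - 1
   sums. *)
Fixpoint nested_sum (p k : nat) (f : nat -> rat) (n : nat) : rat :=
  if k is k'.+1 then \sum_(p <= N < n.+1) nested_sum p k' f N else f n.

(* \sum_(i = a)^b 1 / i, both bounds included; it is 0 when b < a. *)
Definition recip_sum (a b : nat) : rat := \sum_(a <= i < b.+1) (i%:R)^-1.

(* Main.v *)
Require Import Defs.
From mathcomp Require Import all_boot all_order all_algebra.
From mathcomp Require Import ring.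

Import GRing.Theory Num.Theory.
Local Open Scope ring_scope.

(** Write [H_i] for the harmonic numbers.  The summand is the value at [N] of
    [F_d(N) = 'C(N + d, d) * (H_(N + d) - H_d)] for [d = m], and these functions
    obey Pascal's rule [F_(d+1)(N) - F_(d+1)(N - 1) = F_d(N)]: each is a discrete
    antiderivative of the previous one ([harmonic_binom_pascal]).  Hence
    summing [F_d] from [p] to [n] telescopes to [F_(d+1)(n) - F_(d+1)(p - 1)].

    Iterating, each summation raises [d] by one and leaves behind the constant
    [F_(d+1)(p - 1)].  A constant produced by the [i]-th summation is then summed
    [j = k - i] more times, which multiplies it by ['C(n - p + j, j)], by the
    hockey-stick identity.  This bookkeeping uses nothing but Pascal's rule, and
    [nested_sum_pascal] does it for an arbitrary family that satisfies it. *)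

Lemma sum_bin_hockey_stick (j t : nat) :
  (\sum_(0 <= s < t.+1) 'C(s + j, j) = 'C(t + j.+1, j.+1))%N.
Proof.
elim: t => [|t IHt]; first by rewrite big_nat1 !add0n !binn.
by rewrite big_nat_recr //= IHt [in RHS]addSn binS addSnnS.
Qed.

(** The family is indexed by [N + 1] rather than [N], so that the boundary value
    at [p - 1] is [A d p], also for [p = 0]. *)
Lemma nested_sum_pascal (A : nat -> nat -> rat) (m p k t : nat) :
    (forall d q, A d.+1 q.+1 = A d.+1 q + A d q.+1) ->
  nested_sum p k (fun N => A m N.+1) (p + t)
  = A (m + k)%N (p + t).+1
    - \sum_(0 <= j < k) 'C(t + j, j)%:R * A (m + k - j)%N p.
Proof.
move=> pascalA; elim: k t => [|k IHk] t /=.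
  by rewrite big_geq // subr0 addn0.
rewrite -addnS -{1}[p]add0n big_addn addKn.
under eq_bigr => s _ do rewrite addnC IHk.
have antidiff s : A (m + k)%N (p + s).+1
    = A (m + k).+1 (p + s.+1)%N - A (m + k).+1 (p + s)%N.
  by rewrite addnS pascalA addrC addKr.
under eq_bigr => s _ do rewrite antidiff.
rewrite big_split /= telescope_sumr // addn0 sumrN exchange_big_nat //=.
(* The term [j = 0] is the constant left by the outermost summation. *)
rewrite [in RHS]big_nat_recl // bin0 mul1r subn0 opprD !addnS addrA.
congr (_ - _); apply: eq_bigr => j _.
by rewrite subSS -mulr_suml -natr_sum sum_bin_hockey_stick addnS.
Qed.

(** The function [F_d] of the introduction, at [q - 1]. *)
Definition harmonic_binom (d q : nat) : rat :=
  'C((q + d).-1, d)%:R * recip_sum (1 + d) (q + d).-1.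

(** Apply Pascal's rule to the binomial on the left and collect the reciprocals
    that the three harmonic sums do not share: what remains is
    ['C(q + d + 1, d + 1) / (q + d + 1) = 'C(q + d, d) / (d + 1)]. *)
Lemma harmonic_binom_pascal (d q : nat) :
  harmonic_binom d.+1 q.+1 = harmonic_binom d.+1 q + harmonic_binom d q.+1.
Proof.
rewrite /harmonic_binom /recip_sum !addSn !addnS !add0n /=.
(* For [q = 0] all three sums are empty and have no boundary terms to detach. *)
case: q => [|q].
  by rewrite add0n (bin_small (ltnSn d)) mul0r add0r !big_geq // !mulr0.
rewrite addSn [in LHS]big_nat_recr /=; last by rewrite !ltnS leq_addl.
rewrite [in X in _ = _ + X]big_ltn; last by rewrite !ltnS leq_addl.
have := mul_bin_diag (q + d).+2 d => /(congr1 (fun x : nat => x%:R : rat)).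
rewrite !natrM binS natrD /=.
set S := \sum_(_ <= i < _) _; move: S => S.
move: ('C(_, _)%:R) ('C(_, _)%:R) => a b.
have : (q + d).+2%:R != 0 :> rat by rewrite pnatr_eq0.
have : d.+1%:R != 0 :> rat by rewrite pnatr_eq0.
move: (_.+2%:R) (_.+1%:R) => y x x0 y0 absorption.
have -> : (a + b) * (S + y^-1) = (a + b) * S + x * (a + b) / (x * y).
  by field; rewrite x0 y0.
by rewrite -absorption; field; rewrite x0 y0.
Qed.

Theorem theorem4p2 (k m p n : nat) (hk : (0 < k)%N) (hpn : (p <= n)%N) :
  nested_sum p k
    (fun N => 'C(N + m, m)%:R * recip_sum (1 + m) (N + m)) n
  = 'C(n + m + k, m + k)%:R * recip_sum (1 + m + k) (n + m + k)
    - \sum_(0 <= j < k)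
        'C(n - p + j, j)%:R * 'C((p + m + k - j).-1, m + k - j)%:R
          * recip_sum (1 + m + k - j) (p + m + k - j).-1.
Proof.
have := @nested_sum_pascal harmonic_binom m p k (n - p)%N harmonic_binom_pascal.
rewrite subnKC // => ->.
rewrite {1}/harmonic_binom addSn /= !addnA; congr (_ - _).
apply: eq_big_nat => j /andP[_ ltjk].
have lejmk : (j <= m + k)%N by rewrite (leq_trans (ltnW ltjk)) ?leq_addl.
by rewrite /harmonic_binom -mulrA -!addnA !addnBA // !addnA.
Qed.
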